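(* For every integer $k \ge 3$ there is a constant $c = c(k)$ such that for every positive integer $\Delta$ and every $k$-uniform hypergraph $H$ with $n$ vertices and maximum degree $\Delta$: (i) if $k \ge 4$, then $r(H) \le t_k(c\Delta)\, n$; (ii) if $k = 3$, then $r(H) \le t_3(c\Delta\log\Delta)\, n$.
   Context: A hypergraph is $k$-uniform if every edge has exactly $k$ vertices. The degree of a vertex is the number of edges containing it, and the maximum degree is the largest degree of a vertex. $K_N^{(k)}$ denotes the complete $k$-uniform hypergraph on $N$ vertices. The Ramsey number $r(H)$ of a $k$-uniform hypergraph $H$ is the smallest $N$ such that every $2$-colouring of the edges of $K_N^{(k)}$ contains a monochromatic copy of $H$ (a not necessarily induced subhypergraph isomorphic to $H$). The tower function $t_i(x)$ is defined by $t_1(x) = x$ and $t_{i+1}(x) = 2^{t_i(x)}$. *)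

(* Defs.v *)
From HB Require Import structures.
From mathcomp Require Import all_boot all_order all_algebra.
From mathcomp Require Import reals exp.

Set Implicit Arguments.
Unset Strict Implicit.
Unset Printing Implicit Defensive.

Import Order.TTheory GRing.Theory Num.Theory.

Local Open Scope ring_scope.

(** A hypergraph on the vertex set [V] is given by its edge set
    [E : {set {set V}}]; isolated vertices of [V] are allowed. *)

Definition uniform (k : nat) (V : finType) (E : {set {set V}}) : Prop :=
  forall e : {set V}, e \in E -> #|e| = k.

Definition degree (V : finType) (E : {set {set V}}) (v : V) : nat :=
  #|[set e in E | v \in e]|.

Definition max_degree (V : finType) (E : {set {set V}}) : nat :=
  \max_(v : V) degree E v.

Definition complete_hypergraph (k N : nat) : {set {set 'I_N}} :=
  [set e : {set 'I_N} | #|e| == k].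

(** [F] contains a copy of [E]: a subhypergraph of [F], not necessarily
    induced, isomorphic to [E]. *)
Definition contains_copy (W V : finType) (F : {set {set W}})
    (E : {set {set V}}) : Prop :=
  exists f : V -> W,
    injective f /\ forall e : {set V}, e \in E -> f @: e \in F.

(** A colouring is given on all subsets of ['I_N], but only its values on the
    edges of the complete [k]-uniform hypergraph are used. *)
Definition color_class (k N : nat) (chi : {set 'I_N} -> bool) (b : bool) :
    {set {set 'I_N}} :=
  [set e in complete_hypergraph k N | chi e == b].

Definition ramsey_property (k : nat) (V : finType) (E : {set {set V}})
    (N : nat) : Prop :=
  forall chi : {set 'I_N} -> bool,
    exists b : bool, contains_copy (color_class k chi b) E.

Definition is_ramsey_number (k : nat) (V : finType) (E : {set {set V}})
    (r : nat) : Prop :=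
  ramsey_property k E r /\
  forall N : nat, ramsey_property k E N -> (r <= N)%N.

(** [tower 1 x = x] and [tower i.+1 x = 2 `^ tower i x] for [0 < i]; the
    value at [i = 0] is a dummy. *)
Definition tower (R : realType) (i : nat) (x : R) : R :=
  iter i.-1 (fun y : R => 2 `^ y) x.

(* Main.v *)
Require Import Defs.
From HB Require Import structures.
From mathcomp Require Import all_boot all_order all_algebra.
From mathcomp Require Import reals exp zify.

(** Colour the vertices of [H] with [l = k * Delta + 1] colours so that every edge is
    rainbow, and pad the edges with private dummy vertices so that [H] becomes [l]-partite
    and [l]-uniform, still of maximum degree [Delta].  If [q] is the Ramsey number of the
    complete [k]-graph on [l] vertices, then for one of the two colours a proportion of at
    least [1 / (2 q^l)] of all [l]-tuples of vertices are monochromatic; call this set of tuples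
    [G].  Dependent random choice, applied to the coordinates from the last to the first,
    yields sets [G_l = G, G_(l-1), ..., G_0], where [G_i] constrains only the first [i]
    coordinates, such that nearly all families of at most [Delta] tuples of [G_i] have a
    large common neighbourhood in the next coordinate.  Each round raises the inverse
    density to a power [O(Delta^2)], hence [q^(Delta^O(Delta))] in total.  The
    vertices of [H] are then embedded part by part, keeping under control, for every vertex
    still to come, the proportion of deficient extensions of the partial embedding.
    Erdos-Rado bounds [q] by a tower of height [k] in [O(Delta)]; for [k = 3] the factor
    [Delta^O(Delta)] in the second exponent accounts for the logarithm.  For [k = 3] and
    [Delta = 1] the claimed bound is [2 n] since [ln 1 = 0], and [H] is a matching. *)

Set Implicit Arguments.
Unset Strict Implicit.
Unset Printing Implicit Defensive.

Import Order.TTheory GRing.Theory Num.Theory.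

(** * Counting in finite types *)

Lemma markov_card (T : finType) (A : {pred T}) (F : T -> nat) (c : nat) :
  #|[set x in A | c <= F x]| * c <= \sum_(x in A) F x.
Proof.
rewrite -sum_nat_const (bigID (fun x => c <= F x) (mem A)) /=.
rewrite (eq_bigl (fun x => (x \in A) && (c <= F x))); last by move=> x; rewrite inE.
by apply: leq_trans (leq_addr _ _); apply: leq_sum => x /andP[].
Qed.

Lemma sum_card_exchange (S T : finType) (P : S -> T -> bool) :
  \sum_(x : S) #|[set y | P x y]| = \sum_(y : T) #|[set x | P x y]|.
Proof.
transitivity (\sum_(x : S) \sum_(y : T) (P x y : nat)).
  by apply: eq_bigr => x _; rewrite -sum1_card big_mkcond /=;
    apply: eq_bigr => y _; rewrite inE; case: ifP.
rewrite exchange_big /=.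
by apply: eq_bigr => y _; rewrite -sum1_card [RHS]big_mkcond /=;
  apply: eq_bigr => x _; rewrite inE; case: ifP.
Qed.

Lemma card_bigcup_leq (I T : finType) (A : {set I}) (F : I -> {set T}) :
  #|\bigcup_(i in A) F i| <= \sum_(i in A) #|F i|.
Proof.
elim/big_rec2: _ => [|i n B _ IH]; first by rewrite cards0.
by rewrite cardsU; apply: leq_trans (leq_subr _ _) _; rewrite leq_add2l.
Qed.

Lemma pigeonhole_fibre (T P : finType) (C : {set T}) (D : {set P}) (h : T -> P) :
  {in C, forall x, h x \in D} -> 0 < #|D| ->
  exists2 p, p \in D & #|C| <= #|[set x in C | h x == p]| * #|D|.
Proof.
move=> hCD D0; case/card_gt0P: D0 => p0 p0D.
pose F p := #|[set x in C | h x == p]|.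
case: (@arg_maxnP _ p0 (mem D) F p0D) => p pD pmax; exists p => //.
have -> : C = \bigcup_(p in D) [set x in C | h x == p].
  apply/setP => x; apply/idP/bigcupP => [xC|[q _]]; last by rewrite inE => /andP[].
  by exists (h x); [exact: hCD|rewrite inE xC eqxx].
apply: leq_trans (card_bigcup_leq _ _) _.
have -> : \bigcup_(p in D) [set x in C | h x == p] = C.
  apply/setP => x; apply/bigcupP/idP => [[q _]|xC]; first by rewrite inE => /andP[].
  by exists (h x); [exact: hCD|rewrite inE xC eqxx].
rewrite mulnC -sum_nat_const; apply: leq_sum => q qD; exact: pmax.
Qed.

(** These functions form a dependent product with one choice at each point of [sigma @: S] and all
    of [W] at the other points. *)
Lemma card_ffun_prescribed (I D W : finType) (S : {set I}) (sigma : I -> D) (f : I -> W) :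
  {in S &, injective sigma} ->
  #|[set y : {ffun D -> W} | [forall i in S, y (sigma i) == f i]]| = #|W| ^ (#|D| - #|S|).
Proof.
move=> inj; pose F (d : D) : pred W :=
  if [pick i in S | sigma i == d] is Some i then pred1 (f i) else predT.
have Fs i : i \in S -> F (sigma i) = pred1 (f i).
  move=> iS; rewrite /F; case: pickP => [i' /andP[i'S /eqP e]|/(_ i)].
    by rewrite (inj _ _ i'S iS e).
  by rewrite iS eqxx.
have Fn d : d \notin sigma @: S -> F d = predT.
  move=> dS; rewrite /F; case: pickP => // i /andP[iS /eqP e].
  by rewrite -e imset_f in dS.
transitivity #|family F|.
  apply: eq_card => y; rewrite inE; apply/forall_inP/familyP => [H d|H i iS].
    have [/imsetP[i iS ->]|dS] := boolP (d \in sigma @: S); last by rewrite Fn.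
    by rewrite Fs // inE H.
  by have := H (sigma i); rewrite Fs // inE.
rewrite card_family foldrE big_map big_enum /=.
rewrite (bigID (mem (sigma @: S))) /= big1 ?mul1n => [|d /imsetP[i iS ->]]; last by rewrite Fs // card1.
rewrite (eq_bigr (fun _ => #|W|)) => [|d dS]; last by rewrite Fn.
rewrite prod_nat_const; congr (_ ^ _); rewrite -(card_in_imset inj).
by rewrite -(cardsC (sigma @: S)) addKn; apply: eq_card => d; rewrite inE.
Qed.

Lemma injection_into_ord (X : finType) (S : {set X}) (n : nat) :
  #|S| <= n -> 0 < n -> exists iota : X -> 'I_n, {in S &, injective iota}.
Proof.
case: n => // n Sn _; exists (fun x => inord (index x (enum S))).
have lt x : x \in S -> index x (enum S) < n.+1.
  by move=> xS; apply: leq_trans Sn; rewrite cardE index_mem mem_enum.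
move=> x y xS yS /(congr1 (@nat_of_ord _)); rewrite !inordK ?lt // => e.
by rewrite -(nth_index x (s := enum S) (x := x)) ?mem_enum // e nth_index ?mem_enum.
Qed.

Lemma leq_bin_exp (n k : nat) : 'C(n, k) <= n ^ k.
Proof.
apply: leq_trans (_ : n ^_ k <= _).
  by rewrite -bin_ffact leq_pmulr ?fact_gt0.
elim: k n => // k IH [|n]; first by rewrite ffact0n.
rewrite ffactSS expnS leq_mul2l /=; apply: leq_trans (IH n) _.
by case: k {IH} => // k; rewrite leq_exp2r.
Qed.

(** * Ramsey numbers of complete hypergraphs *)

(* Step of the Erdos-Rado argument: [g] records the colour that a [k]-subset
   of [A] takes together with any vertex of [C]. *)
Lemma end_homogeneous_extension (T : finType) (chi : {set T} -> bool) (k M m : nat)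
    (A C : {set T}) (g : {set T} -> bool) :
  #|A| + m <= M -> [disjoint A & C] -> 2 ^ ((M ^ k).+1 * m) <= #|C| ->
  (forall (S : {set T}) x, S \subset A -> #|S| = k.+1 -> x \in C -> chi (x |: S) = g S) ->
  (forall S : {set T}, S \subset A -> #|S| = k.+2 -> exists2 x, x \in S & chi S = g (S :\ x)) ->
  exists (B : {set T}) (g' : {set T} -> bool), [/\ #|B| = #|A| + m, B \subset A :|: C &
   forall S : {set T}, S \subset B -> #|S| = k.+2 -> exists2 x, x \in S & chi S = g' (S :\ x)].
Proof.
elim: m A C g => [|m IH] A C g AM dAC hC gC gA.
  by exists A, g; rewrite addn0 subsetUl.
have C0 : 0 < #|C| by apply: leq_trans hC; rewrite expn_gt0.
case/card_gt0P: (C0) => a aC.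
have aA : a \notin A by apply/negP => aA; move: (disjointFr dAC aA); rewrite aC.
(* Each remaining vertex [x] is classified by the [k]-subsets [S] of [A] for which [x], [a] and [S]
   together get colour [true]. There are at most [2 ^ (M ^ k)] classes; the successor in
   [(M ^ k).+1] pays for removing [a]. *)
pose DD := [set S : {set T} | (S \subset A) && (#|S| == k)].
pose h x := [set S in DD | chi (x |: (a |: S))].
have hD x : x \in C :\ a -> h x \in powerset DD.
  by move=> _; rewrite inE; apply/subsetP => S; rewrite inE => /andP[].
have [|p _ hp] := pigeonhole_fibre hD; first by rewrite card_powerset expn_gt0.
set C' := [set x in C :\ a | h x == p] in hp.
(* Sets through [a] take their colour from the chosen class [p]; the others keep the colour given by
   [g]. *)
pose g' (S : {set T}) := if a \in S then S :\ a \in p else g S.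
have hDD : #|DD| <= M ^ k.
  rewrite cards_draws; apply: leq_trans (leq_bin_exp _ _) _.
  by case: (k) => // k'; rewrite leq_exp2r //; lia.
have hC' : 2 ^ ((M ^ k).+1 * m) <= #|C'|.
  have h1 : 2 ^ ((M ^ k).+1 * m) * 2 ^ (M ^ k) <= #|C :\ a|.
    have := cardsD1 a C; rewrite aC -expnD => e.
    have : 2 ^ ((M ^ k).+1 * m + M ^ k) * 2 <= #|C|.
      by rewrite -expnSr (leq_trans _ hC) // leq_pexp2l //; lia.
    have : 0 < 2 ^ ((M ^ k).+1 * m + M ^ k) by rewrite expn_gt0.
    by rewrite e; lia.
  have := leq_trans h1 hp; rewrite card_powerset => h2.
  have h3 : #|C'| * 2 ^ #|DD| <= #|C'| * 2 ^ (M ^ k) by rewrite leq_mul2l leq_pexp2l ?orbT.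
  by have := leq_trans h2 h3; rewrite leq_pmul2r // expn_gt0.
have C'C x : x \in C' -> (x \in C) && (x != a) /\ h x = p.
  by rewrite !inE => /andP[/andP[-> ->] /eqP].
have [|||S x SA' Sk xC'||B [g'' [cB sB hB]]] := IH (a |: A) C' g'.
- by rewrite cardsU1 aA; lia.
- rewrite disjoint_sym; apply/pred0P => x /=; apply/negbTE/andP => -[/C'C[/andP[xC xa] _]].
  by rewrite in_setU1 (negbTE xa) /=; apply/negP; apply: contraL xC => /(disjointFr dAC) ->.
- exact: hC'.
- have [/andP[xC xa] hx] := C'C _ xC'; rewrite /g'; case: ifP => aS.
    have SaA : S :\ a \subset A by rewrite subDset.
    rewrite -hx !inE SaA /= setD1K //.
    by have := cardsD1 a S; rewrite aS Sk add1n => -[<-]; rewrite eqxx.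
  apply: gC => //; apply/subsetP => z zS; move/subsetP/(_ _ zS): SA'.
  by rewrite in_setU1 => /orP[/eqP za|//]; rewrite -za zS in aS.
- move=> S SA' Sk; have [aS|aS] := boolP (a \in S).
    exists a => //; rewrite /g' setD11 -(gC (S :\ a) a) ?setD1K // ?subDset //.
    by have := cardsD1 a S; rewrite aS Sk add1n => -[].
  have SA : S \subset A.
    apply/subsetP => z zS; move/subsetP/(_ _ zS): SA'.
    by rewrite in_setU1 => /orP[/eqP za|//]; rewrite -za zS in aS.
  have [x xS ->] := gA S SA Sk; exists x => //.
  by rewrite /g' in_setD1 (negbTE aS) andbF.
exists B, g''; split=> //; first by rewrite cB cardsU1 aA; lia.
apply: subset_trans sB _; apply/subsetP => x; rewrite !in_setU in_set1.
by case/orP => [/orP[/eqP->|->]|/C'C[/andP[-> _] _]]; rewrite ?aC ?orbT.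
Qed.

(** Arbitrary subsets of arbitrary finite types are allowed because the induction on [k] works
    inside an end-homogeneous subset, with its auxiliary colouring. *)
Definition ramsey_bound (k l q : nat) : Prop :=
  forall (T : finType) (chi : {set T} -> bool) (B : {set T}), q <= #|B| ->
  exists (b : bool) (A : {set T}), [/\ A \subset B, #|A| = l &
    forall S : {set T}, S \subset A -> #|S| = k -> chi S = b].

Lemma subset_of_card (T : finType) (B : {set T}) (m : nat) :
  m <= #|B| -> exists2 A : {set T}, A \subset B & #|A| = m.
Proof.
move=> mB; have : 0 < #|[set A : {set T} | A \subset B & #|A| == m]|.
  by rewrite cards_draws bin_gt0.
by case/card_gt0P => A; rewrite inE => /andP[AB /eqP cA]; exists A.
Qed.

Lemma ramsey_bound1 (l : nat) : ramsey_bound 1 l l.*2.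
Proof.
move=> T chi B hB.
have [b hb] : exists b, l <= #|[set x in B | chi [set x] == b]|.
  case: (leqP l #|[set x in B | chi [set x] == true]|) => h1; first by exists true.
  exists false; have := cardsID [set x | chi [set x]] B.
  have -> : B :&: [set x | chi [set x]] = [set x in B | chi [set x] == true].
    by apply/setP => x; rewrite !inE eqb_id.
  have -> : B :\: [set x | chi [set x]] = [set x in B | chi [set x] == false].
    by apply/setP => x; rewrite !inE eqbF_neg andbC.
  by lia.
have [A AB cA] := subset_of_card hb; exists b, A; split=> //.
  by apply: subset_trans AB _; apply/subsetP => x; rewrite inE => /andP[].
move=> S SA /eqP/cards1P[x Sx]; rewrite Sx.
have : x \in A by apply: (subsetP SA); rewrite Sx set11.
by move/(subsetP AB); rewrite inE => /andP[_ /eqP].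
Qed.

(** Starting from the empty set, [q] extension steps give an end-homogeneous set of size [q]. Its
    colours are governed by a colouring of [k.+1]-sets, to which the hypothesis applies. *)
Lemma ramsey_boundS (k l q : nat) :
  ramsey_bound k.+1 l q -> ramsey_bound k.+2 l (2 ^ ((q ^ k).+1 * q)).
Proof.
move=> Rk T chi B hB.
have [||||B' [g [cB sB hg]]] :=
  @end_homogeneous_extension T chi k q q set0 B (fun _ => true) _ _ hB.
- by rewrite cards0.
- by rewrite -setI_eq0 set0I.
- by move=> S x; rewrite subset0 => /eqP ->; rewrite cards0.
- by move=> S; rewrite subset0 => /eqP ->; rewrite cards0.
rewrite cards0 add0n in cB; rewrite set0U in sB.
have [|b [A [AB cA hA]]] := Rk T g B'; first by rewrite cB.
exists b, A; split=> //; first exact: subset_trans AB sB.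
move=> S SA Sk; have [x xS ->] := hg S (subset_trans SA AB) Sk.
apply: hA; first exact: subset_trans (subsetDl _ _) SA.
by have := cardsD1 x S; rewrite xS Sk add1n => -[].
Qed.

(** * Dependent random choice *)

Definition update (l : nat) (W : finType) (x : {ffun 'I_l -> W}) (i : 'I_l) (w : W) :
    {ffun 'I_l -> W} :=
  [ffun j => if j == i then w else x j].

Definition pullback (l D : nat) (W : finType) (y : {ffun 'I_D -> W})
    (s : {ffun 'I_l -> 'I_D}) : {ffun 'I_l -> W} :=
  [ffun j => y (s j)].

(** Encodes a set of [i]-tuples by full [l]-tuples, so that all rounds share one type and one
    normalisation [#|W| ^ l]. *)
Definition depends_below (l : nat) (W : finType) (i : nat)
    (G : {set {ffun 'I_l -> W}}) : Prop :=
  forall x y : {ffun 'I_l -> W}, (forall j : 'I_l, j < i -> x j = y j) ->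
  (x \in G) = (y \in G).

(* [Q] lists the tuples of positions occupied by the edges at a vertex: ranging over all
   [Q] accounts for every way in which these edges may intersect, with a number of
   cases that does not depend on [W]. *)
Definition deficient (l D : nat) (W : finType) (B : nat) (i : 'I_l)
    (G' G : {set {ffun 'I_l -> W}}) (Q : {set {ffun 'I_l -> 'I_D}}) :
    {set {ffun 'I_D -> W}} :=
  [set y | [forall s in Q, pullback y s \in G'] &&
     (#|[set w | [forall s in Q, update (pullback y s) i w \in G]]| * B < #|W|)].

(** What a random sample [ws] of [t] vertices, repetitions allowed, leaves of [G] once coordinate
    [i] is eliminated. *)
Definition common_link (l t : nat) (W : finType) (G : {set {ffun 'I_l -> W}})
    (i : 'I_l) (ws : {ffun 'I_t -> W}) : {set {ffun 'I_l -> W}} :=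
  [set x | [forall s, update x i (ws s) \in G]].

Lemma depends_common_link (l t : nat) (W : finType) (G : {set {ffun 'I_l -> W}})
    (i : 'I_l) (ws : {ffun 'I_t -> W}) :
  depends_below i.+1 G -> depends_below i (common_link G i ws).
Proof.
move=> hG x y exy; rewrite !inE; apply: eq_forallb => s; apply: hG => j ji.
rewrite !ffunE; case: eqP => // /eqP jni; apply: exy.
by rewrite ltn_neqAle jni -ltnS.
Qed.

Lemma card_ffun_in (t : nat) (W : finType) (A : {set W}) :
  #|[set ws : {ffun 'I_t -> W} | [forall s, ws s \in A]]| = #|A| ^ t.
Proof.
rewrite -[t in RHS]card_ord -card_ffun_on; apply: eq_card => ws; rewrite inE.
by apply/forallP/ffun_onP.
Qed.

(** Exchanging the entry at [i] with the spare vertex [w] is an involution on pairs, and it carries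
    the counted pairs onto the product of [G] and [W]. *)
Lemma sum_card_link (l : nat) (W : finType) (G : {set {ffun 'I_l -> W}}) (i : 'I_l) :
  \sum_x #|[set w | update x i w \in G]| = #|W| * #|G|.
Proof.
pose h (p : {ffun 'I_l -> W} * W) := (update p.1 i p.2, p.1 i).
have hh : involutive h.
  move=> [x w]; rewrite /h /=; congr (_, _); last by rewrite ffunE eqxx.
  by apply/ffunP => j; rewrite !ffunE; case: eqP => [->|].
transitivity (#|[set p | (h p).1 \in G]|).
  rewrite -sum1dep_card (eq_bigl (fun p : {ffun 'I_l -> W} * W =>
    xpredT p.1 && ((h (p.1, p.2)).1 \in G))); last by case.
  rewrite -(pair_big_dep xpredT (fun x w => (h (x, w)).1 \in G) (fun _ _ => 1)) /=.
  by apply: eq_bigr => x _; rewrite sum1dep_card.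
have -> : [set p | (h p).1 \in G] = h @^-1: setX G setT.
  by apply/setP => p; rewrite !inE andbT.
rewrite -(can2_imset_pre _ hh hh) card_imset; last exact: inv_inj.
by rewrite cardsX cardsT mulnC.
Qed.

(** The sum equals the sum of the [t]-th powers of the link sizes. In place of convexity, only
    tuples whose link has proportion at least [1 / (2 * E)] are kept; their own density is at least
    [1 / (2 * E)], whence the exponent [t.+1]. *)
Lemma sum_card_common_link (l t E : nat) (W : finType) (G : {set {ffun 'I_l -> W}})
    (i : 'I_l) :
  #|W| ^ l <= #|G| * E ->
  #|W| ^ l * #|W| ^ t <=
    (2 * E) ^ t.+1 * \sum_(ws : {ffun 'I_t -> W}) #|common_link G i ws|.
Proof.
move=> hG; pose d (x : {ffun 'I_l -> W}) := #|[set w | update x i w \in G]|.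
have -> : \sum_(ws : {ffun 'I_t -> W}) #|common_link G i ws| = \sum_x d x ^ t.
  rewrite -(sum_card_exchange (fun x
    (ws : {ffun 'I_t -> W}) => [forall s, update x i (ws s) \in G])).
  apply: eq_bigr => x _; rewrite -card_ffun_in; congr #|pred_of_set _|.
  by apply/setP => ws; rewrite !inE; apply: eq_forallb => s; rewrite inE.
set N := #|W| in hG *.
have [N0|N0] := posnP N.
  by rewrite N0 exp0n // (leq_ltn_trans _ (ltn_ord i)).
pose H := [set x | N <= d x * (2 * E)].
have dN x : d x <= N by rewrite /d /N max_card.
have hH : N ^ l <= #|H| * (2 * E).
  have s1 : N * #|G| * (2 * E) <= #|H| * N * (2 * E) + N ^ l * N.
    rewrite -(sum_card_link G i) (bigID (mem H)) /= mulnDl leq_add //.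
      rewrite leq_mul2r -sum_nat_const; apply/orP; right; apply: leq_sum => x _; exact: dN.
    rewrite big_distrl /=.
    apply: (@leq_trans (\sum_(x in [set: {ffun 'I_l -> W}]) N)).
      rewrite [leqRHS](bigID (fun x => x \notin H)) /=.
      apply: leq_trans (leq_addr _ _).
      rewrite [leqRHS](eq_bigl (fun x => x \notin H)); last by move=> x; rewrite inE.
      by apply: leq_sum => x; rewrite inE -ltnNge => /ltnW.
    by rewrite sum_nat_const cardsT card_ffun card_ord.
  have : N * (N ^ l * 2) <= N * (#|H| * (2 * E) + N ^ l).
    by apply: leq_trans (_ : N * (#|G| * E * 2) <= _); [rewrite leq_mul2l leq_mul2r hG !orbT|nia].
  rewrite leq_pmul2l //; lia.
apply: (@leq_trans (#|H| * (2 * E) * N ^ t)); first by rewrite leq_mul2r hH orbT.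
apply: (@leq_trans ((2 * E) ^ t.+1 * \sum_(x in H) d x ^ t)).
  rewrite expnS -[leqRHS]mulnA -mulnA mulnCA leq_mul2l; apply/orP; right.
  rewrite big_distrr /= -sum_nat_const; apply: leq_sum => x.
  rewrite inE mulnC => hx; rewrite -expnMn; case: (t) => // t'.
  by rewrite leq_exp2r.
by rewrite leq_mul2l [leqRHS](bigID (mem H)) /= leq_addr orbT.
Qed.

(** A configuration is deficient for a sample only if the whole sample falls in its set of common
    neighbours and this set has proportion below [1 / B]; the chance is at most [1 / B ^ t]. *)
Lemma sum_card_deficient (l D t B : nat) (W : finType) (G : {set {ffun 'I_l -> W}})
    (i : 'I_l) (Q : {set {ffun 'I_l -> 'I_D}}) :
  (\sum_(ws : {ffun 'I_t -> W}) #|deficient B i (common_link G i ws) G Q|) * B ^ t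
    <= #|W| ^ D * #|W| ^ t.
Proof.
pose C (y : {ffun 'I_D -> W}) := [set w | [forall s in Q, update (pullback y s) i w \in G]].
pose P (ws : {ffun 'I_t -> W}) (y : {ffun 'I_D -> W}) :=
  [forall r, ws r \in C y] && (#|C y| * B < #|W|).
have -> : \sum_(ws : {ffun 'I_t -> W}) #|deficient B i (common_link G i ws) G Q|
    = \sum_ws #|[set y | P ws y]|.
  apply: eq_bigr => ws _; congr #|pred_of_set _|; apply/setP => y; rewrite !inE.
  congr (_ && _); apply/forall_inP/forallP => [H r|H s sQ].
    by rewrite inE; apply/forall_inP => s sQ; have := H s sQ; rewrite inE => /forallP.
  by rewrite inE; apply/forallP => r; have := H r; rewrite inE => /forall_inP; apply.
rewrite sum_card_exchange big_distrl /=.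
have -> : #|W| ^ D * #|W| ^ t = \sum_(y : {ffun 'I_D -> W}) #|W| ^ t.
  by rewrite sum_nat_const card_ffun card_ord.
apply: leq_sum => y _; have [hC|hC] := boolP (#|C y| * B < #|W|); last first.
  have -> : [set ws | P ws y] = set0 by apply/setP => ws; rewrite !inE /P (negbTE hC) andbF.
  by rewrite cards0.
have -> : [set ws | P ws y] = [set ws : {ffun 'I_t -> W} | [forall r, ws r \in C y]].
  by apply/setP => ws; rewrite !inE /P hC andbT.
rewrite card_ffun_in -expnMn; case: (t) => // t'.
by rewrite leq_exp2r // ltnW.
Qed.

(** By averaging, a proportion of at least [1 / (2 * (2 * E) ^ t.+1)] of the samples leaves a dense
    link, while each [Q] spoils at most [Z / B ^ t] of them. The numerical hypothesis lets a good
    sample survive the union bound over all [Q]. *)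
Lemma dependent_random_choice (l D t B E Z : nat) (W : finType)
    (G : {set {ffun 'I_l -> W}}) (i : 'I_l) :
  0 < #|W| -> depends_below i.+1 G -> #|W| ^ l <= #|G| * E ->
  #|{set {ffun 'I_l -> 'I_D}}| * Z * (2 * (2 * E) ^ t.+1) < B ^ t ->
  exists G' : {set {ffun 'I_l -> W}},
    [/\ depends_below i G', #|W| ^ l <= #|G'| * (2 * (2 * E) ^ t.+1) &
      forall Q : {set {ffun 'I_l -> 'I_D}}, #|deficient B i G' G Q| * Z <= #|W| ^ D].
Proof.
set N := #|W|; set P := #|{set _}|; set F := (2 * E) ^ t.+1.
move=> N0 hG hE hB.
pose good := [set ws : {ffun 'I_t -> W} | N ^ l <= #|common_link G i ws| * (2 * F)].
pose bad (Q : {set {ffun 'I_l -> 'I_D}}) := [set ws : {ffun 'I_t -> W} |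
  N ^ D < #|deficient B i (common_link G i ws) G Q| * Z].
have Nl0 : 0 < N ^ l by rewrite expn_gt0 N0.
have ND0 : 0 < N ^ D by rewrite expn_gt0 N0.
have Nt0 : 0 < N ^ t by rewrite expn_gt0 N0.
have hgood : N ^ t <= #|good| * (2 * F).
  have := sum_card_common_link t i hE; rewrite -/N -/F.
  set S := \sum_ws _ => hS.
  have : S * (2 * F) <= (#|good| * (2 * F) + N ^ t) * N ^ l.
    rewrite /S (bigID (mem good)) /= !mulnDl leq_add //.
      rewrite mulnAC leq_mul2r -sum_nat_const; apply/orP; right.
      apply: leq_sum => ws _; apply: leq_trans (max_card _) _.
      by rewrite card_ffun card_ord.
    rewrite big_distrl /=.
    apply: (@leq_trans (\sum_(ws : {ffun 'I_t -> W}) N ^ l)); last first.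
      by rewrite sum_nat_const card_ffun card_ord.
    rewrite [leqRHS](bigID (fun ws => ws \notin good)) /=.
    apply: leq_trans (leq_addr _ _); apply: leq_sum => ws.
    by rewrite inE -ltnNge => /ltnW.
  by move=> h; rewrite -(leq_pmul2r Nl0); nia.
have hbad Q : #|bad Q| * B ^ t <= Z * N ^ t.
  have h1 := @markov_card _ predT (fun ws : {ffun 'I_t -> W} =>
    #|deficient B i (common_link G i ws) G Q| * Z) (N ^ D).
  have h2 : #|bad Q| * N ^ D <=
      (\sum_(ws : {ffun 'I_t -> W}) #|deficient B i (common_link G i ws) G Q|) * Z.
    rewrite big_distrl /=; apply: leq_trans h1; rewrite leq_mul2r subset_leq_card ?orbT //.
    by apply/subsetP => ws; rewrite !inE => /ltnW.
  have h3 := sum_card_deficient t B G i Q; rewrite -/N in h3.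
  move: h2 h3; set Sd := \sum_ws _ => h2 h3.
  have h4 : #|bad Q| * N ^ D * B ^ t <= Sd * Z * B ^ t by rewrite leq_mul2r h2 orbT.
  have h5 : Sd * B ^ t * Z <= N ^ D * N ^ t * Z by rewrite leq_mul2r h3 orbT.
  by rewrite -(leq_pmul2r ND0); lia.
have [ws [wg wb]] : exists ws, ws \in good /\ forall Q, ws \notin bad Q.
  case: (pickP [pred ws | (ws \in good) && [forall Q, ws \notin bad Q]]) => [ws /andP[? /forallP ?]|no].
    by exists ws.
  have sub : good \subset \bigcup_(Q in [set: {set {ffun 'I_l -> 'I_D}}]) bad Q.
    apply/subsetP => ws wg; have := no ws; rewrite /= wg => /negbT; rewrite negb_forall.
    by case/existsP => Q; rewrite negbK => wQ; apply/bigcupP; exists Q; rewrite ?in_setT.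
  have := leq_trans (subset_leq_card sub) (card_bigcup_leq _ _) => h.
  have : #|good| * B ^ t <= P * (Z * N ^ t).
    apply: (@leq_trans ((\sum_(Q in [set: {set {ffun 'I_l -> 'I_D}}]) #|bad Q|) * B ^ t)).
      by rewrite leq_mul2r h orbT.
    rewrite big_distrl /= /P -cardsT -sum_nat_const; apply: leq_sum => Q _; exact: hbad.
  have : N ^ t * B ^ t <= #|good| * (2 * F) * B ^ t by rewrite leq_mul2r hgood orbT.
  move=> h4 h5; suff : B ^ t <= P * Z * (2 * F) by lia.
  by rewrite -(leq_pmul2l Nt0); nia.
exists (common_link G i ws); split; first exact: depends_common_link.
  by move: wg; rewrite inE.
by move=> Q; have := wb Q; rewrite inE -leqNgt.
Qed.

(* Bound on the inverse density after [m] rounds. *)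
Definition chain_density (t E m : nat) : nat := iter m (fun e => 2 * (2 * e) ^ t.+1) E.

Lemma chain_density_gt0 (t E m : nat) : 0 < E -> 0 < chain_density t E m.
Proof. by move=> E0; elim: m => //= m IH; rewrite muln_gt0 expn_gt0 muln_gt0 IH. Qed.

Lemma leq_chain_density (t E m m' : nat) :
  0 < E -> m <= m' -> chain_density t E m <= chain_density t E m'.
Proof.
move=> E0 /subnK <-; elim: (m' - m) => //= n IH; apply: leq_trans IH _.
have := chain_density_gt0 t (n + m) E0; rewrite /chain_density.
by set e := iter _ _ _ => e0; rewrite expnS; have : 0 < (2 * e) ^ t by [rewrite expn_gt0 muln_gt0 e0]; nia.
Qed.

Lemma drc_chain (l D t B E Z : nat) (W : finType) (G : {set {ffun 'I_l -> W}}) :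
  0 < #|W| -> 0 < E -> #|W| ^ l <= #|G| * E ->
  #|{set {ffun 'I_l -> 'I_D}}| * Z * chain_density t E l < B ^ t ->
  exists Gs : nat -> {set {ffun 'I_l -> W}},
    [/\ Gs l = G, Gs 0 = setT, forall i, i <= l -> depends_below i (Gs i) &
      forall (i : 'I_l) (Q : {set {ffun 'I_l -> 'I_D}}),
        #|deficient B i (Gs i) (Gs i.+1) Q| * Z <= #|W| ^ D].
Proof.
move=> N0 E0 hE hB.
have : forall m, m <= l -> exists Gs : nat -> {set {ffun 'I_l -> W}},
    [/\ Gs l = G, #|W| ^ l <= #|Gs (l - m)| * chain_density t E m,
     forall i, l - m <= i <= l -> depends_below i (Gs i) &
      forall (i : 'I_l) (Q : {set {ffun 'I_l -> 'I_D}}), l - m <= i ->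
        #|deficient B i (Gs i) (Gs i.+1) Q| * Z <= #|W| ^ D].
  elim=> [_|m IH ml].
    (* Before any round only the value at [l] is constrained, so a constant sequence serves. *)
    exists (fun _ => G); rewrite subn0; split=> // [i il|i Q].
      have -> : i = l by lia.
      by move=> x y exy; have -> : x = y by apply/ffunP => j; exact: exy.
    by rewrite leqNgt ltn_ord.
  have [|Gs [GsG dens dep def]] := IH; first exact: ltnW.
  have ilt : l - m.+1 < l by lia.
  pose i0 := Ordinal ilt.
  have i0S : i0.+1 = l - m by rewrite /=; lia.
  have [|||G' [dep' dens' def']] :=
    @dependent_random_choice l D t B (chain_density t E m) Z W (Gs i0.+1) i0 N0.
  - by apply: dep; rewrite i0S; lia.
  - by rewrite i0S.
  - apply: leq_ltn_trans hB; rewrite leq_mul2l; apply/orP; right.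
    exact: (leq_chain_density t E0 ml).
  exists (fun i => if i == l - m.+1 then G' else Gs i); split.
  - by rewrite gtn_eqF.
  - by rewrite eqxx.
  - by move=> i hi; case: eqP => [->//|ne]; apply: dep; lia.
  - move=> i Q hi; have [e|ne] := eqVneq (i : nat) (l - m.+1).
      have -> : i = i0 by apply: val_inj.
      by rewrite ifN ?def' //= neq_ltn ltnSn orbT.
    by rewrite ifN; [apply: def; lia | lia].
move/(_ l (leqnn l)); rewrite subnn => -[Gs [GsG dens dep def]].
exists Gs; split=> //; last by move=> i Q; apply: def.
(* [Gs 0] has positive density and constrains no coordinate, so it is everything. *)
have [x xG] : exists x, x \in Gs 0.
  apply/set0Pn; apply/negP => /eqP e; move: dens.
  by rewrite e cards0 mul0n leqn0 expn_eq0 -[_ == 0]negbK -lt0n N0.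
apply/setP => y; rewrite inE -xG; exact: (dep 0 _ y x).
Qed.

(** * Greedy embedding *)

Section GreedyEmbedding.

Variables (l D B Z : nat) (W X J : finType) (part : X -> 'I_l) (ev : J -> {ffun 'I_l -> X}).
Variable Gs : nat -> {set {ffun 'I_l -> W}}.

Hypothesis part_ev : forall j i, part (ev j i) = i.
Hypothesis degD : forall u, #|[set j | ev j (part u) == u]| * l <= D.
Hypothesis B0 : 0 < B.
Hypothesis D0 : 0 < D.
Hypothesis hZ : (2 * D * B) ^ D < Z.
Hypothesis hW : 2 * B * #|X| < #|W|.
Hypothesis Gs0 : Gs 0 = setT.
Hypothesis depGs : forall i, i <= l -> depends_below i (Gs i).
Hypothesis defGs : forall (i : 'I_l) (Q : {set {ffun 'I_l -> 'I_D}}),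
  #|deficient B i (Gs i) (Gs i.+1) Q| * Z <= #|W| ^ D.

Let N := #|W|.
Let K := 2 * D * B.

(** Since [ev j i] always lies in part [i], the equation [ev j (part u) = u] expresses that edge [j]
    contains [u]. *)
Let link u := [set j | ev j (part u) == u].
Let nbrs u := [set x | [exists j, (ev j (part u) == u) && (ev j (part x) == x)]].
Let back u := [set x in nbrs u | part x < part u].

Lemma card_nbrs u : #|nbrs u| <= D.
Proof.
apply: leq_trans (degD u); rewrite -[l in _ * l]card_ord -cardsT -cardsX.
apply: leq_trans (leq_imset_card (fun p : J * 'I_l => ev p.1 p.2) _).
apply: subset_leq_card; apply/subsetP => x; rewrite inE => /existsP[j /andP[ju /eqP jx]].
by apply/imsetP; exists (j, part x); rewrite ?inE ?ju.
Qed.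

Lemma nbrs_sym u v : (v \in nbrs u) = (u \in nbrs v).
Proof. by rewrite !inE; apply: eq_existsb => j; rewrite andbC. Qed.

Lemma card_back u : #|back u| <= D.
Proof.
apply: leq_trans (card_nbrs u); apply: subset_leq_card.
by apply/subsetP => x; rewrite inE => /andP[].
Qed.

Lemma back_ev u j (i : 'I_l) : j \in link u -> i < part u -> ev j i \in back u.
Proof.
rewrite inE => ju iu; rewrite !inE part_ev iu andbT.
by apply/existsP; exists j; rewrite ju eqxx.
Qed.

Variable iota : X -> X -> 'I_D.
Hypothesis iota_inj : forall u, {in back u &, injective (iota u)}.

(** The edges at [u] written as positions of earlier neighbours: [Gs (part u)] reads exactly the
    parts where [iota u] is injective on the vertices involved. *)
Let pattern u : {set {ffun 'I_l -> 'I_D}} := [set [ffun i => iota u (ev j i)] | j in link u].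
Let bad u := deficient B (part u) (Gs (part u)) (Gs (part u).+1) (pattern u).
Let image_edge (f : X -> W) j : {ffun 'I_l -> W} := [ffun i => f (ev j i)].
Let cands (f : X -> W) u :=
  [set w | [forall j in link u, update (image_edge f j) (part u) w \in Gs (part u).+1]].
Let compat (A : {set X}) (f : X -> W) u :=
  [set y in bad u | [forall x in back u :&: A, y (iota u x) == f x]].

(* The last clause says that conditioning on the embedded neighbours of [u] has increased
   the proportion of deficient configurations by at most [K] for each of them. *)
Let invariant (A : {set X}) (f : X -> W) :=
  [/\ forall x y, x \in A -> part y < part x -> y \in A,
      {in A &, injective f},
      forall j i, i <= l -> (forall i' : 'I_l, i' < i -> ev j i' \in A) -> image_edge f j \in Gs i &
      forall u, #|compat A f u| * Z * N ^ #|back u :&: A| <= N ^ D * K ^ #|back u :&: A|].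

(** With no vertex embedded, the third clause concerns only [i = 0], where [Gs 0] is full, and the
    fourth reduces to [defGs]. *)
Lemma invariant0 f : invariant set0 f.
Proof.
split=> //.
- by move=> x y; rewrite inE.
- by move=> x y; rewrite inE.
- move=> j [|i] il hi; first by rewrite Gs0 inE.
  by have := hi (Ordinal (leq_ltn_trans (leq0n i) il)) isT; rewrite inE.
- move=> u; rewrite setI0 cards0 !muln1; apply: leq_trans (defGs (part u) (pattern u)).
  rewrite leq_mul2r subset_leq_card ?orbT //.
  by apply/subsetP => y; rewrite inE => /andP[].
Qed.

(** If [u] had too few candidates, all [N ^ (D - s)] configurations agreeing with [f] on the [s]
    earlier neighbours would be deficient. The invariant would then give [Z <= K ^ s], against
    [hZ]. *)
Lemma card_cands A f u :
  invariant A f -> back u \subset A -> N <= #|cands f u| * B.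
Proof.
move=> [_ _ hG hc] uA; rewrite leqNgt; apply/negP => small.
have := hc u; rewrite (setIidPl uA).
have -> : compat A f u = [set y : {ffun 'I_D -> W} | [forall x in back u, y (iota u x) == f x]].
  apply/setP => y; rewrite !inE (setIidPl uA); apply: andb_idl => /forall_inP hy.
  have yE j (i : 'I_l) : j \in link u -> i < part u ->
      pullback y [ffun i => iota u (ev j i)] i = image_edge f j i.
    by move=> ju iu; rewrite !ffunE; apply/eqP; apply: hy; exact: back_ev.
  apply/andP; split.
    apply/forall_inP => s /imsetP[j ju ->].
    rewrite (depGs (ltnW (ltn_ord _)) (y := image_edge f j)); last by move=> i; exact: yE.
    apply: hG => [|i iu]; first exact: ltnW.
    by apply: (subsetP uA); exact: back_ev.
  apply: leq_ltn_trans small; rewrite leq_mul2r; apply/orP; right.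
  apply: subset_leq_card; apply/subsetP => w; rewrite !inE => /forall_inP hw.
  apply/forall_inP => j ju.
  rewrite (depGs (ltn_ord _) (y := update (pullback y [ffun i => iota u (ev j i)]) (part u) w)).
    by apply: hw; apply: imset_f.
  move=> i iu; rewrite [LHS]ffunE [RHS]ffunE; case: eqP => // /eqP ne.
  by rewrite yE // ltn_neqAle ne -ltnS.
rewrite (card_ffun_prescribed _ (@iota_inj u)) card_ord.
set s := #|back u|; have sD : s <= D := card_back u.
rewrite mulnAC -expnD subnK // leq_pmul2l; last by rewrite expn_gt0 (leq_ltn_trans _ hW).
have KD : K ^ s <= K ^ D by rewrite leq_pexp2l // /K; lia.
by move=> h; have := leq_trans h KD; rewrite leqNgt hZ.
Qed.

Let extend (f : X -> W) (v : X) (w : W) (x : X) : W := if x == v then w else f x.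

(** Fixing the image of [v] splits [compat A f u] according to the value at position [iota u v]. *)
Lemma sum_compat_extend (A : {set X}) f u v : v \in back u -> v \notin A ->
  \sum_w #|compat (v |: A) (extend f v w) u| <= #|compat A f u|.
Proof.
move=> vu vA.
have sub w : compat (v |: A) (extend f v w) u \subset [set y in compat A f u | y (iota u v) == w].
  apply/subsetP => y; rewrite !inE => /andP[-> /forall_inP H] /=.
  have := H v; rewrite inE vu setU11 /extend eqxx => -> //; rewrite andbT.
  apply/forall_inP => x; rewrite inE => /andP[xu xA].
  have := H x; rewrite inE xu in_setU1 xA orbT => /(_ isT); rewrite /extend ifN //.
  by apply: contraNneq vA => <-.
apply: (@leq_trans (\sum_w #|[set y in compat A f u | y (iota u v) == w]|)).
  by apply: leq_sum => w _; apply: subset_leq_card.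
rewrite (eq_bigr (fun w => \sum_(y in compat A f u | y (iota u v) == w) 1)); last first.
  by move=> w _; rewrite sum1dep_card; apply: eq_card => y; rewrite !inE.
by rewrite -(partition_big (fun y : {ffun 'I_D -> W} => y (iota u v)) xpredT) //= sum1_card.
Qed.

(** The image of [v] is chosen among at least [N / B] candidates. Fewer than [N / (2 * B)] vertices
    are already used, and each of the at most [D] later neighbours forbids at most [N / K] by
    Markov's inequality, in total at most [N / (2 * B)]. *)
Lemma invariant_extend (A : {set X}) f v : invariant A f -> v \notin A ->
  (forall x, part x < part v -> x \in A) ->
  exists w, invariant (v |: A) (extend f v w).
Proof.
move=> inv vA minv; have [down finj hG hc] := inv.
have backA : back v \subset A.
  by apply/subsetP => x; rewrite inE => /andP[_ /minv].
have hC := card_cands inv backA.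
have N0 : 0 < N by apply: leq_ltn_trans hW.
pose U := [set u | v \in back u].
pose T u := [set w | K * #|compat A f u| < #|compat (v |: A) (extend f v w) u| * N].
have cU : #|U| <= D.
  apply: leq_trans (card_nbrs v); apply: subset_leq_card.
  by apply/subsetP => u; rewrite inE => /setIdP[]; rewrite nbrs_sym.
have cT u : u \in U -> #|T u| * K <= N.
  rewrite inE => vu; have := sum_compat_extend f vu vA.
  have := @markov_card _ predT
    (fun w => #|compat (v |: A) (extend f v w) u| * N) (K * #|compat A f u|).+1.
  have -> : [set x in predT | K * #|compat A f u| < #|compat (v |: A) (extend f v x) u| * N] = T u.
    by apply/setP => w; rewrite !inE.
  rewrite -big_distrl /=; set c := #|compat A f u|; set S := \sum_w _ => h1 h2.
  have h3 : #|T u| * (K * c).+1 <= c * N by apply: leq_trans h1 _; rewrite leq_mul2r h2 orbT.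
  have [c0|c0] := posnP c; first by rewrite c0 in h3; nia.
  by rewrite -(leq_pmul2l c0); nia.
have [w [wC wA wT]] : exists w,
      [/\ w \in cands f v, w \notin f @: A & forall u, u \in U -> w \notin T u].
  case: (pickP [pred w | [&& w \in cands f v, w \notin f @: A & w \notin \bigcup_(u in U) T u]]).
    move=> w /and3P[w1 w2 w3]; exists w; split=> // u uU.
    by apply: contra w3 => wT; apply/bigcupP; exists u.
  move=> no; exfalso.
  have sub : cands f v \subset f @: A :|: \bigcup_(u in U) T u.
    apply/subsetP => w wC; rewrite in_setU; have := no w; rewrite /= wC /=.
    by case: (_ \in f @: A) => //= /negbFE.
  have h1 := leq_trans (subset_leq_card sub) (leq_card_setU _ _).
  have h2 : #|f @: A| <= #|X| by apply: leq_trans (leq_imset_card _ _) (max_card _).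
  have h3 : #|\bigcup_(u in U) T u| * K <= D * N.
    apply: leq_trans (_ : (\sum_(u in U) #|T u|) * K <= _).
      by rewrite leq_mul2r card_bigcup_leq orbT.
    rewrite big_distrl /=; apply: leq_trans (_ : #|U| * N <= _); last by rewrite leq_mul2r cU orbT.
    by rewrite -sum_nat_const; apply: leq_sum.
  have h4 : #|\bigcup_(u in U) T u| * (2 * B) <= N by rewrite -(leq_pmul2l D0) /K in h3 *; nia.
  move: hW h1 h2 h4 hC; rewrite -/N.
  set a := #|cands f v|; set b := #|f @: A|; set c := #|\bigcup_(u in U) T u|.
  by move=> *; nia.
exists w; set f' := extend f v w.
have f'E x : x \in A -> f' x = f x.
  by move=> xA; rewrite /f' /extend ifN //; apply: contraNneq vA => <-.
have f'v : f' v = w by rewrite /f' /extend eqxx.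
split.
- move=> x y; rewrite !in_setU1 => /orP[/eqP->|xA] yx; apply/orP; right; first exact: minv.
  exact: down yx.
- move=> x y; rewrite !in_setU1 => /orP[/eqP->|xA] /orP[/eqP->|yA] //.
  + by rewrite f'v f'E // => e; rewrite e imset_f in wA.
  + by rewrite f'v f'E // => e; rewrite -e imset_f in wA.
  + by rewrite !f'E //; exact: finj.
- move=> j i il hi.
  have [/existsP[i0 /andP[i0i /eqP i0v]]|] := boolP [exists i0 : 'I_l, (i0 < i) && (ev j i0 == v)].
    have i0p : i0 = part v by rewrite -i0v part_ev.
    (* As [A] is closed under earlier parts, an edge whose first [i] vertices are embedded and
       include [v] has [v] as the last of them; the candidacy of [w] then gives the claim. *)
    have iE : i = (part v).+1.
      apply/eqP; rewrite eqn_leq -{2}i0p i0i andbT leqNgt; apply/negP => lt.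
      have lt' : (part v).+1 < l by apply: leq_trans il.
      have := hi (Ordinal lt') lt; rewrite in_setU1 => /orP[/eqP e|xA].
        by have := congr1 (fun x => val (part x)) e; rewrite part_ev /=; lia.
      by case/negP: vA; apply: down xA _; rewrite part_ev.
    rewrite iE; have := wC; rewrite inE => /forall_inP/(_ j); rewrite inE -{1}i0p i0v eqxx => /(_ isT).
    rewrite (depGs (ltn_ord _) (y := image_edge f' j)) // => i1 i1v.
    rewrite !ffunE; case: eqP => [->|/eqP ne]; first by rewrite -i0p i0v f'v.
    rewrite f'E // minv // part_ev ltn_neqAle ne; exact: i1v.
  rewrite negb_exists => /forallP nov.
  have hA (i' : 'I_l) : i' < i -> ev j i' \in A.
    by move=> lt; have := hi i' lt; have := nov i'; rewrite lt in_setU1 /= => /negbTE ->.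
  rewrite (depGs il (y := image_edge f j)); first exact: hG.
  by move=> i' lt; rewrite !ffunE f'E // hA.
- move=> u; have [vu|vu] := boolP (v \in back u); last first.
    have e : back u :&: (v |: A) = back u :&: A.
      apply/setP => x; rewrite !in_setI in_setU1; case: eqP => [->|//].
      by rewrite (negbTE vu).
    have -> : compat (v |: A) f' u = compat A f u.
      apply/setP => y; rewrite !inE e; congr (_ && _); apply: eq_forallb => x.
      by apply: implyb_id2l; rewrite inE => /andP[_ xA]; rewrite f'E.
    by rewrite e.
  have -> : #|back u :&: (v |: A)| = #|back u :&: A|.+1.
    have -> : back u :&: (v |: A) = v |: (back u :&: A).
      by rewrite setIUr (setIidPr _) // sub1set.
    by rewrite cardsU1 in_setI (negbTE vA) andbF.
  have := hc u; have := wT u; rewrite inE vu => /(_ isT).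
  rewrite inE -leqNgt !expnS; set c := #|compat A f u|; set c' := #|compat _ _ _|.
  set s := #|_ :&: _| => h1 h2.
  have h3 : c' * N * (Z * N ^ s) <= K * c * (Z * N ^ s) by rewrite leq_mul2r h1 orbT.
  have h4 : K * (c * Z * N ^ s) <= K * (N ^ D * K ^ s) by rewrite leq_mul2l h2 orbT.
  by lia.
Qed.

Lemma greedy_embedding :
  exists f : X -> W, injective f /\ forall j, image_edge f j \in Gs l.
Proof.
have [w0 _] : exists w0 : W, w0 \in W by apply/card_gt0P; apply: leq_ltn_trans hW.
have : forall m, m <= #|X| -> exists (A : {set X}) f, #|A| = m /\ invariant A f.
  elim=> [_|m IH mX]; first by exists set0, (fun _ => w0); rewrite cards0; split=> //; exact: invariant0.
  have [A [f [cA inv]]] := IH (ltnW mX).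
  have [x0 x0A] : exists x, x \in ~: A.
    by apply/card_gt0P; have := cardsC A; lia.
  (* Taking a remaining vertex of least part keeps the embedded set closed under earlier parts. *)
  case: (@arg_minnP _ x0 (mem (~: A)) (fun x => part x : nat) x0A) => v vA minv.
  have {}vA : v \notin A by rewrite -in_setC.
  have [|w invw] := invariant_extend inv vA.
    move=> x; apply: contraTT => xA; rewrite -leqNgt; apply: minv.
    by rewrite /= in_setC.
  exists (v |: A), (extend f v w); split; last exact: invw.
  by rewrite cardsU1 vA cA.
case/(_ #|X| (leqnn _)) => A [f [cA [_ finj hG _]]].
have AT : A = setT by apply/eqP; rewrite eqEcard subsetT cardsT cA leqnn.
exists f; split; first by move=> x y; apply: finj; rewrite AT inE.
by move=> j; apply: hG => // i _; rewrite AT inE.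
Qed.

End GreedyEmbedding.

(** The value of [B] for samples of size [t = 2 * D]: it is [2 * D] times [2 * P * c], with [P] the
    number of patterns and [c] the final chain density. Of [B ^ (2 * D)], one factor [B ^ D] occurs
    in [Z] and the other absorbs [(2 * D) ^ D * (2 * P * c)]. *)
Definition sparsity (l D E : nat) : nat :=
  4 * #|{set {ffun 'I_l -> 'I_D}}| * D * chain_density (2 * D) E l.

Lemma partite_embedding (l D E : nat) (W X J : finType) (part : X -> 'I_l)
    (ev : J -> {ffun 'I_l -> X}) (G : {set {ffun 'I_l -> W}}) :
  (forall j i, part (ev j i) = i) ->
  (forall u, #|[set j | ev j (part u) == u]| * l <= D) ->
  0 < D -> 0 < E -> #|W| ^ l <= #|G| * E -> 2 * sparsity l D E * #|X| < #|W| ->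
  exists f : X -> W, injective f /\ forall j, [ffun i => f (ev j i)] \in G.
Proof.
move=> part_ev deg D0 E0 hE hW.
have N0 : 0 < #|W| by apply: leq_ltn_trans hW.
pose P := #|{set {ffun 'I_l -> 'I_D}}|; pose c := chain_density (2 * D) E l.
have P0 : 0 < P by apply/card_gt0P; exists set0.
have c0 : 0 < c by exact: chain_density_gt0.
set B := sparsity l D E in hW.
have BE : B = 2 * D * (2 * P * c) by rewrite /B /sparsity -/P -/c; nia.
have Pc0 : 0 < P * c by rewrite muln_gt0 P0.
have DPc0 : 0 < D * (P * c) by rewrite muln_gt0 D0.
have B0 : 0 < B by rewrite BE; nia.
(* The least value that meets the requirement [hZ] of the greedy embedding. *)
pose Z := ((2 * D * B) ^ D).+1.
have [|Gs [GsG Gs0 dep def]] := @drc_chain l D (2 * D) B E Z W G N0 E0 hE.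
  rewrite -/P -/c mul2n -addnn expnD.
  have h1 : (2 * D) ^ D * (2 * P * c) <= B ^ D.
    rewrite BE [leqRHS]expnMn leq_mul2l; apply/orP; right.
    by case: (D) D0 => // D' _; rewrite expnS leq_pmulr // expn_gt0; apply/orP; left; nia.
  have h2 : 1 < (2 * D * B) ^ D.
    by apply: leq_ltn_trans (ltn_expl _ _) => //; nia.
  have h3 : (2 * D) ^ D * (2 * P * c) * B ^ D <= B ^ D * B ^ D by rewrite leq_mul2r h1 orbT.
  rewrite /Z; move: h2 h3; rewrite expnMn; set x := (2 * D) ^ D; set y := B ^ D => h2 h3.
  by apply: leq_trans h3; nia.
pose nb u := [set x | [exists j, (ev j (part u) == u) && (ev j (part x) == x)]].
have hiota u : exists iota : X -> 'I_D, {in [set x in nb u | part x < part u] &, injective iota}.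
  by apply: injection_into_ord => //; exact: card_back deg _.
have [iota hi] := fin_all_exists hiota.
rewrite -GsG.
by apply: (@greedy_embedding l D B Z W X J part ev Gs part_ev deg B0 D0 _ hW Gs0 dep def iota hi).
Qed.

(** * From hypergraphs to tuples *)

Definition mono_tuples (k l : nat) (W : finType) (chi : {set W} -> bool) (b : bool) :
    {set {ffun 'I_l -> W}} :=
  [set x : {ffun 'I_l -> W} | [forall S : {set 'I_l}, (#|S| == k) ==> (chi (x @: S) == b)]].

(** The colouring sending [S] to [chi (y @: S)] makes sense for every [q]-tuple [y], injective or
    not, so each [y] contains a monochromatic [l]-tuple at some injective choice of positions.
    Counting the [y] over at most [q ^ l] choices and two colours, the more frequent colour wins. *)
Lemma mono_tuple_density (k l q : nat) (W : finType) (chi : {set W} -> bool) :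
  0 < l -> ramsey_bound k l q ->
  exists b, #|W| ^ l <= #|mono_tuples k l chi b| * (2 * q ^ l).
Proof.
move=> l0 Rq; set N := #|W|.
have [N0|N0] := posnP N; first by exists true; rewrite N0 exp0n.
case/card_gt0P: (N0) => w0 _.
pose I := [set p : {ffun 'I_l -> 'I_q} * bool | injectiveb p.1].
pose F (p : {ffun 'I_l -> 'I_q} * bool) :=
  [set y : {ffun 'I_q -> W} | pullback y p.1 \in mono_tuples k l chi p.2].
have cover (y : {ffun 'I_q -> W}) : exists2 p, p \in I & y \in F p.
  have [|b [A [_ cA hA]]] := Rq _ (fun S : {set 'I_q} => chi (y @: S)) setT.
    by rewrite cardsT card_ord.
  pose s : {ffun 'I_l -> 'I_q} := [ffun i => enum_val (cast_ord (esym cA) i)].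
  have sinj : injective s by move=> i j; rewrite !ffunE => /enum_val_inj/cast_ord_inj.
  exists (s, b); first by rewrite inE; apply/injectiveP.
  rewrite !inE; apply/forallP => S; apply/implyP => /eqP cS.
  have -> : pullback y s @: S = y @: (s @: S).
    by rewrite -imset_comp; apply: eq_imset => i; rewrite /= ffunE.
  apply/eqP/hA; last by rewrite card_imset.
  by apply/subsetP => _ /imsetP[i _ ->]; rewrite ffunE enum_valP.
have lq : l <= q.
  have [[s b]] := cover [ffun=> w0]; rewrite inE => /injectiveP /= sinj _.
  by have := leq_card s sinj; rewrite !card_ord.
have cF p : p \in I -> #|F p| = #|mono_tuples k l chi p.2| * N ^ (q - l).
  rewrite inE => /injectiveP sinj.
  rewrite -sum_nat_const -sum1dep_card.
  rewrite (partition_big (fun y => pullback y p.1) (mem (mono_tuples k l chi p.2))) //=.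
  apply: eq_bigr => x xG; rewrite sum1dep_card.
  have := @card_ffun_prescribed _ _ W [set: 'I_l] p.1 x (in2W sinj).
  rewrite cardsT !card_ord => <-; apply: eq_card => y; rewrite !inE.
  apply/andP/forall_inP => [[_ /eqP <-] i _|H]; first by rewrite ffunE.
  have -> : pullback y p.1 = x by apply/ffunP => i; rewrite ffunE; apply/eqP/H.
  by split; [by move: xG; rewrite /= inE|exact: eqxx].
have h1 : N ^ q <= \sum_(p in I) #|F p|.
  have -> : N ^ q = #|[set: {ffun 'I_q -> W}]| by rewrite cardsT card_ffun card_ord.
  apply: leq_trans (card_bigcup_leq _ _); apply: subset_leq_card.
  by apply/subsetP => y _; apply/bigcupP; have [p] := cover y; exists p.
pose M b := #|mono_tuples k l chi b|.
have h2 : N ^ q <= q ^ l * (M true + M false) * N ^ (q - l).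
  apply: leq_trans h1 _; rewrite (eq_bigr (fun p => M p.2 * N ^ (q - l))) //.
  rewrite -big_distrl leq_mul2r /=; apply/orP; right.
  apply: (@leq_trans (\sum_(p : {ffun 'I_l -> 'I_q} * bool) M p.2)).
    by rewrite [leqRHS](bigID (mem I)) /= leq_addr.
  rewrite -(pair_big xpredT xpredT (fun _ b => M b)) /= sum_nat_const card_ffun !card_ord.
  by rewrite leq_mul2l big_bool leqnn orbT.
have h3 : N ^ l <= q ^ l * (M true + M false).
  by rewrite -(leq_pmul2r (_ : 0 < N ^ (q - l))) ?expn_gt0 ?N0 // -expnD subnKC.
case: (leqP (M false) (M true)) => h; [exists true|exists false]; apply: leq_trans h3 _;
  rewrite [leqRHS]mulnA [leqRHS]mulnC leq_mul2l -/(M _); apply/orP; right; lia.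
Qed.

(** Greedy colouring: the edges at a vertex cover at most [d * k] vertices, which leaves one of the
    [l] colours free. *)
Lemma strong_coloring (V : finType) (E : {set {set V}}) (k d l : nat) :
  (forall e, e \in E -> #|e| <= k) -> (forall v, degree E v <= d) -> d * k < l ->
  exists col : V -> 'I_l, forall e, e \in E -> {in e &, injective col}.
Proof.
move=> hk hd hl.
have c0 : 'I_l by apply: (@Ordinal l 0); apply: leq_ltn_trans hl.
have main : forall s : seq V, exists col : V -> 'I_l, forall e : {set V}, e \in E ->
    {in [pred x in e | x \in s] &, injective col}.
  elim=> [|v s [col IH]]; first by exists (fun=> c0) => e _ x y; rewrite !inE andbF.
  pose nb := \bigcup_(e in [set e in E | v \in e]) e.
  have cnb : #|col @: nb| < l.
    apply: leq_ltn_trans hl; apply: leq_trans (leq_imset_card _ _) _.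
    apply: leq_trans (card_bigcup_leq _ _) _.
    apply: leq_trans (_ : \sum_(e in [set e in E | v \in e]) k <= _).
      by apply: leq_sum => e; rewrite inE => /andP[/hk].
    by rewrite sum_nat_const leq_mul2r hd orbT.
  have [c cN] : exists c, c \notin col @: nb.
    case: (pickP [pred c | c \notin col @: nb]) => [c|no]; first by exists c.
    suff : #|col @: nb| = l by move=> e; rewrite e ltnn in cnb.
    rewrite -[RHS]card_ord; apply: eq_card => c; rewrite inE.
    by have /= /negbFE := no c.
  exists (fun x => if x == v then c else col x) => e eE.
  have fresh x : v \in e -> x \in e -> c != col x.
    move=> ve xe; apply: contraNneq cN => ->; apply: imset_f.
    by apply/bigcupP; exists e; rewrite ?inE ?eE.
  move=> x y; rewrite !inE => /andP[xe xs] /andP[ye ys].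
  case: eqP => [xv|/eqP xv]; case: eqP => [yv|/eqP yv] => ec.
  - by rewrite xv yv.
  - by have := fresh y; rewrite -xv ec eqxx => /(_ xe ye).
  - by have := fresh x; rewrite -yv ec eqxx => /(_ ye xe).
  - move: xs ys; rewrite (negbTE xv) (negbTE yv) /= => xs ys.
    by apply: (IH e eE); rewrite ?inE ?xe ?ye.
have [col hcol] := main (enum V); exists col => e eE x y xe ye.
by apply: (hcol e eE); rewrite inE ?xe ?ye mem_enum.
Qed.

Lemma card_edges_leq (V : finType) (E : {set {set V}}) (d : nat) :
  (forall e, e \in E -> 0 < #|e|) -> (forall v, degree E v <= d) -> #|E| <= #|V| * d.
Proof.
move=> h0 hd.
have sub : E \subset \bigcup_(v in [set: V]) [set e in E | v \in e].
  apply/subsetP => e eE; have := h0 e eE => /card_gt0P[v ve].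
  by apply/bigcupP; exists v; rewrite ?inE ?eE.
apply: leq_trans (subset_leq_card sub) _; apply: leq_trans (card_bigcup_leq _ _) _.
by rewrite -cardsT -sum_nat_const; apply: leq_sum => v _; exact: hd.
Qed.

Lemma sparse_ramsey_property (V : finType) (E : {set {set V}}) (k d l q N : nat) :
  0 < k -> 0 < d -> uniform k E -> (forall v, degree E v <= d) ->
  d * k < l -> ramsey_bound k l q -> 0 < q ->
  2 * sparsity l (d * l) (2 * q ^ l) * (#|V| * (d * l).+1) < N ->
  ramsey_property k E N.
Proof.
move=> k0 d0 unif deg dl Rq q0 hN chi.
have l0 : 0 < l by apply: leq_ltn_trans dl.
have [b hb] := @mono_tuple_density k l q 'I_N chi l0 Rq.
exists b.
have [|col hcol] := @strong_coloring V E k d l _ deg dl; first by move=> e /unif ->.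
pose J := {e : {set V} | e \in E}.
(* The dummy [(j, i)] fills part [i] of edge [j] when [j] has no vertex of colour [i]. It lies in no
   other edge, so degrees stay at most [d]. *)
pose X := (V + J * 'I_l)%type.
pose part (x : X) : 'I_l := match x with inl v => col v | inr p => p.2 end.
pose ev (j : J) : {ffun 'I_l -> X} :=
  [ffun i => if [pick v in val j | col v == i] is Some v then inl v else inr (j, i)].
have part_ev j i : part (ev j i) = i.
  by rewrite ffunE; case: pickP => //= v /andP[_ /eqP].
have ev_in (j : J) v : v \in val j -> ev j (col v) = inl v.
  move=> vj; rewrite ffunE; case: pickP => [u /andP[uj /eqP e]|/(_ v)]; last by rewrite vj eqxx.
  by rewrite (hcol (val j) (valP j) u v).
have in_ev (j : J) v i : ev j i == inl v -> v \in val j.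
  by rewrite ffunE; case: pickP => // u /andP[uj _] /eqP e; have [<-] : u = v by case: e.
have hdeg u : #|[set j | ev j (part u) == u]| * l <= d * l.
  rewrite leq_mul2r; apply/orP; right; case: u => [v|[j i]] /=.
    apply: leq_trans (deg v); rewrite /degree -(card_imset _ val_inj).
    apply: subset_leq_card; apply/subsetP => e' /imsetP[j]; rewrite inE => jv e'E; rewrite e'E.
    by rewrite inE (valP j) /=; exact: in_ev jv.
  apply: leq_trans d0; rewrite -(cards1 j); apply: subset_leq_card.
  apply/subsetP => j'; rewrite !inE ffunE; case: pickP => // _.
  by move=> /eqP[->].
have [||||f [finj hf]] := @partite_embedding l (d * l) (2 * q ^ l) 'I_N X J part ev
    (mono_tuples k l chi b) part_ev hdeg.
- by rewrite muln_gt0 d0.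
- by rewrite muln_gt0 expn_gt0 q0.
- exact: hb.
(* There are [l] dummies per edge and at most [#|V| * d] edges, whence the factor [(d * l).+1]. *)
- rewrite [ltnRHS]card_ord; apply: leq_ltn_trans hN; rewrite leq_mul2l; apply/orP; right.
  rewrite card_sum card_prod card_ord card_sig mulnS leq_add2l mulnA leq_mul2r.
  apply/orP; right; apply: leq_trans (card_edges_leq _ deg); first by apply: subset_leq_card; apply/subsetP.
  by move=> e /unif ->.
exists (fun v => f (inl v)); split; first by move=> u v /finj[].
move=> e eE; pose j : J := exist _ e eE.
(* The coordinates in [col @: e] select the [k] true vertices of [e], so this instance gives the
   colour of the image of [e]. *)
have := hf j; rewrite inE => /forallP/(_ (col @: e)).
rewrite card_in_imset ?(unif e eE) ?eqxx; last exact: (hcol e eE).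
rewrite /= => /eqP hc.
have im : [ffun i => f (ev j i)] @: (col @: e) = (fun v => f (inl v)) @: e.
  rewrite -imset_comp; apply: eq_in_imset => v ve /=.
  by rewrite ffunE ev_in.
rewrite im in hc; rewrite !inE hc eqxx andbT card_imset ?(unif e eE) //.
by move=> u v /finj[].
Qed.

(** * Matchings *)

(** [B] is sent into [C] by matching positions in the two enumerations; disjointness keeps new
    images apart from old ones. *)
Lemma extend_injection (V W : finType) (f : V -> W) (A B : {set V}) (C : {set W}) :
  {in A &, injective f} -> [disjoint A & B] -> [disjoint f @: A & C] -> #|B| <= #|C| ->
  exists f' : V -> W, [/\ {in A, f' =1 f}, {in A :|: B &, injective f'} & f' @: B \subset C].
Proof.
move=> finj dAB dfC BC.
have BA x : x \in A -> x \in B = false by move=> xA; rewrite (disjointFr dAB xA).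
pose f' x := if x \in B then nth (f x) (enum C) (index x (enum B)) else f x.
have lt x : x \in B -> index x (enum B) < size (enum C).
  by move=> xB; rewrite -cardE; apply: leq_trans BC; rewrite cardE index_mem mem_enum.
have f'C x : x \in B -> f' x \in C.
  by move=> xB; rewrite /f' xB -mem_enum mem_nth ?lt.
have f'A x : x \in A -> f' x = f x by move=> xA; rewrite /f' BA.
have sep x y : x \in A -> y \in B -> f' x <> f' y.
  move=> xA yB e; have := f'C y yB; rewrite -e f'A //.
  by rewrite (disjointFr dfC) // imset_f.
exists f'; split=> //; last by apply/subsetP => _ /imsetP[x xB ->]; exact: f'C.
move=> x y; rewrite !in_setU => /orP[xA|xB] /orP[yA|yB] e.
- by move: e; rewrite !f'A //; exact: finj.
- by case: (sep x y).
- by case: (sep y x).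
- move: e; rewrite /f' xB yB (set_nth_default (f y)) ?lt // => /eqP.
  rewrite nth_uniq ?lt ?enum_uniq // => /eqP e.
  by rewrite -(nth_index x (s := enum B) (x := x)) ?mem_enum // e nth_index ?mem_enum.
Qed.

(* Embed the edges greedily in colour [true]; if this gets stuck, the unused
   vertices span no edge of that colour, and there are enough of them for [V]. *)
Lemma matching_ramsey_property (V : finType) (E : {set {set V}}) (k : nat) :
  0 < #|V| -> uniform k E -> (forall v, degree E v <= 1) ->
  ramsey_property k E (2 * #|V|).
Proof.
move=> V0 unif deg chi; set N := 2 * #|V|.
have N0 : 0 < N by rewrite /N; lia.
pose w0 : 'I_N := Ordinal N0.
have disj (e e' : {set V}) v : e \in E -> e' \in E -> v \in e -> v \in e' -> e = e'.
  move=> eE e'E ve ve'; have := deg v; rewrite /degree => /card_le1_eqP; apply; by rewrite inE ?eE ?e'E.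
have main (es : seq {set V}) : uniq es -> {subset es <= E} ->
    (exists f : V -> 'I_N, {in \bigcup_(e <- es) e &, injective f} /\
       {in es, forall e : {set V}, chi (f @: e) = true}) \/
    (exists2 U : {set 'I_N}, #|V| <= #|U| &
       forall S : {set 'I_N}, S \subset U -> #|S| = k -> chi S = false).
  elim: es => [|e es IH] /=.
    by left; exists (fun=> w0); rewrite big_nil; split=> // x y; rewrite inE.
  move=> /andP[ees ues] sub.
  have eE : e \in E by apply: sub; rewrite inE eqxx.
  have [e' e'es|[f [finj fE]]|] := IH ues; last by right.
    by apply: sub; rewrite inE e'es orbT.
  set A := \bigcup_(e <- es) e in finj.
  have dAe : [disjoint A & e].
    rewrite disjoint_sym; apply/pred0P => v /=; apply/negP => /andP[ve].
    rewrite /A big_seq; elim/big_rec: _ => [|e' B e'es IHB]; first by rewrite inE.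
    rewrite in_setU => /orP[ve'|//]; case/negP: ees.
    by rewrite (disj e e' v) // sub // inE e'es orbT.
  have cU : #|V| <= #|~: (f @: A)|.
    have := cardsC (f @: A); rewrite card_ord.
    have := leq_imset_card f A; have : #|A| <= #|V| := max_card _.
    by rewrite /N; lia.
  case: (pickP [pred S : {set 'I_N} | [&& S \subset ~: (f @: A), #|S| == k & chi S]]) => [S|no]; last first.
    right; exists (~: (f @: A)) => // S SU cS; have := no S.
    by rewrite /= SU cS eqxx.
  move=> /and3P[SU /eqP cS chiS]; left.
  have [||f' [f'f f'inj f'e]] := extend_injection finj dAe (C := S).
  - by rewrite disjoint_sym disjoints_subset.
  - by rewrite cS (unif e eE).
  exists f'; rewrite big_cons setUC; split=> // e'; rewrite inE => /orP[/eqP ->|e'es].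
    suff -> : f' @: e = S by [].
    apply/eqP; rewrite eqEcard f'e card_in_imset ?cS ?(unif e eE) ?leqnn //.
    by move=> x y xe ye; apply: f'inj; rewrite in_setU ?xe ?ye orbT.
  rewrite -(fE e' e'es); congr chi; apply: eq_in_imset => x xe'; apply: f'f.
  by rewrite /A (big_rem e') //= in_setU xe'.
have [||[f [finj fE]]|[U cU hU]] := main (enum E); first exact: enum_uniq.
- by move=> e; rewrite mem_enum.
- set A := \bigcup_(e <- enum E) e in finj.
  have AE e : e \in E -> e \subset A by move=> eE; rewrite /A big_enum (bigcup_sup e).
  have [|||f' [f'f f'inj _]] := extend_injection finj (B := ~: A) (C := ~: (f @: A)).
  + by rewrite disjoints_subset setCK.
  + by rewrite disjoints_subset setCK.
  + have := cardsC (f @: A); rewrite card_ord; have := cardsC A.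
    by have := leq_imset_card f A; rewrite /N; lia.
  have f'I : injective f' by move=> x y; apply: f'inj; rewrite setUCr inE.
  exists true, f'; split=> // e eE; rewrite !inE card_imset // (unif e eE) eqxx /=.
  rewrite (_ : f' @: e = f @: e) ?fE ?mem_enum //.
  by apply: eq_in_imset => x xe; apply: f'f; apply: (subsetP (AE e eE)).
(* Every [k]-subset of [U] has colour [false], so any injection of [V] into [U] is a copy. *)
- have [||||f [_ finj fU]] := @extend_injection V _ (fun=> w0) set0 setT U.
  + by move=> x y; rewrite inE.
  + by rewrite -setI_eq0 set0I.
  + by rewrite imset0 -setI_eq0 set0I.
  + by rewrite cardsT.
  have fI : injective f by move=> x y; apply: finj; rewrite set0U inE.
  exists false, f; split=> // e eE; rewrite !inE card_imset // (unif e eE) eqxx /=.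
  rewrite hU ?card_imset ?(unif e eE) //.
  by apply: subset_trans fU; apply: imsetS; exact: subsetT.
Qed.

(** * Tower bounds *)

(** The index counts exponentials, so [ntower i] corresponds to [tower i.+1]. *)
Definition ntower (i x : nat) : nat := iter i (expn 2) x.

Lemma leq_ntower i x y : x <= y -> ntower i x <= ntower i y.
Proof. by move=> xy; elim: i => //= i IH; rewrite leq_exp2l. Qed.

Lemma ntower_gt0 i x : 0 < x -> 0 < ntower i x.
Proof. by case: i => //= i _; rewrite expn_gt0. Qed.

Lemma leq_ntower_add i j x : ntower j x <= ntower (i + j) x.
Proof. by elim: i => //= i IH; apply: leq_trans IH _; apply/ltnW/ltn_expl. Qed.

(** At each level [a * 2 ^ y <= 2 ^ (a.-1 + y) <= 2 ^ (a * y)], by [a <= 2 ^ a.-1] and [0 < y]. *)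
Lemma leq_mul_ntower i a x : 0 < a -> 0 < x -> a * ntower i x <= ntower i (a * x).
Proof.
move=> a0 x0; elim: i => //= i IH; apply: leq_trans (_ : 2 ^ (a * ntower i x) <= _); last by rewrite leq_exp2l.
have := ntower_gt0 i x0; set y := ntower i x => y0.
have -> : a * y = a.-1 * y + y by case: a a0 {IH} => //= a _; rewrite mulSn addnC.
rewrite expnD leq_mul2r; apply/orP; right.
apply: leq_trans (_ : 2 ^ a.-1 <= _); last by rewrite leq_exp2l // leq_pmulr.
by have := ltn_expl a.-1 (isT : 1 < 2); lia.
Qed.

Lemma leq_exp_ntower i a x : 0 < a -> 0 < x -> ntower i.+1 x ^ a <= ntower i.+1 (a * x).
Proof. by move=> a0 x0 /=; rewrite -expnM mulnC leq_exp2l // leq_mul_ntower. Qed.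

(** Each increase of uniformity costs one exponential. The exponent [(q ^ k.+1).+1 * q] is at most
    the power [k.+4] of the previous tower, which is absorbed by multiplying the constant by
    [k.+4]. *)
Lemma ramsey_tower (k : nat) : exists2 c, 0 < c &
  forall l, 0 < l -> exists q, [/\ 0 < q, ramsey_bound k.+2 l q & q <= ntower k.+1 (c * l)].
Proof.
elim: k => [|k [c c0 IH]].
  exists 4 => // l l0; exists (2 ^ ((l.*2 ^ 0).+1 * l.*2)); split; first by rewrite expn_gt0.
    exact/ramsey_boundS/ramsey_bound1.
  by rewrite /= leq_exp2l //; lia.
exists (k.+4 * c) => [|l l0]; first by rewrite muln_gt0.
have [q [q0 Rq hq]] := IH l l0.
exists (2 ^ ((q ^ k.+1).+1 * q)); split; [by rewrite expn_gt0|exact: ramsey_boundS|].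
rewrite [ntower _ _]/= -/(ntower k.+1 _) leq_exp2l // -mulnA.
have cl0 : 0 < c * l by rewrite muln_gt0 c0.
apply: leq_trans (leq_exp_ntower k (isT : 0 < k.+4) cl0).
set X := ntower k.+1 (c * l) in hq *.
have X2 : 2 <= X by rewrite /X /= -{1}(expn1 2) leq_exp2l // ntower_gt0.
have h1 : q ^ k.+1 <= X ^ k.+1 by rewrite leq_exp2r.
have h2 : 0 < X ^ k.+1 by rewrite expn_gt0 (ltnW X2).
rewrite (_ : k.+4 = k.+1 + 3); last lia.
rewrite expnD; apply: leq_trans (_ : (X ^ k.+1).+1 * X <= _); first exact: leq_mul.
have h3 : 4 <= X ^ 2 by rewrite (@leq_exp2r 2 X 2).
by rewrite (expnS X 2); nia.
Qed.

Lemma card_set_type (T : finType) : #|{set T}| = 2 ^ #|T|.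
Proof.
rewrite -[#|T|]cardsT -card_powerset; apply: eq_card => A.
by rewrite !inE subsetT.
Qed.

(** One round turns the exponent [y] into [1 + y.+1 * t.+1], at most [(2 * t + 3) * y] as
    [0 < y]. *)
Lemma chain_density_leq (t e m x : nat) :
  0 < x -> e <= 2 ^ x -> chain_density t e m <= 2 ^ (x * (2 * t + 3) ^ m).
Proof.
move=> x0 ex; elim: m => [|m IH]; first by rewrite expn0 muln1.
rewrite [chain_density _ _ _]/= -/(chain_density t e m).
move: IH; set d := chain_density t e m; set y := x * _ ^ m => IH.
have y0 : 0 < y by rewrite muln_gt0 x0 expn_gt0 addn_gt0 orbT.
rewrite (expnSr (2 * t + 3)) mulnA -/y.
apply: leq_trans (_ : 2 * (2 ^ y.+1) ^ t.+1 <= _).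
  by apply: leq_mul => //; rewrite leq_exp2r // (expnS 2 y); exact: leq_mul.
rewrite -expnM -expnS leq_exp2l //; nia.
Qed.

(* [L] stands for [log2 Delta]; only [Delta <= 2 ^ L] matters, which covers
   both the case [k = 3] and the cruder bound sufficient for [k >= 4]. *)
Lemma sparse_ramsey_exponent (k : nat) : exists b c, [/\ 0 < b, 0 < c &
  forall (d L : nat) (V : finType) (E : {set {set V}}),
    0 < d -> 0 < L -> d <= 2 ^ L -> 0 < #|V| -> uniform k.+2 E ->
    (forall v, degree E v <= d) ->
    ramsey_property k.+2 E (2 ^ (ntower k (c * d) * 2 ^ (b * (d * L))) * #|V|)].
Proof.
have [c c0 hc] := ramsey_tower k.
pose K := k.+3.
(* [K * d] bounds the number [l] of parts. In the first constant, [(4 * K + 5) * K] comes from the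
   bound on [Y] and [5 * K + 1] from that on [5 * l]. *)
exists ((4 * K + 5) * K + 5 * K + 1), (c * K); split; [lia | by rewrite muln_gt0 c0 |].
move=> d L V E d0 L0 dL V0 unif deg.
pose l := (d * k.+2).+1; pose D := d * l.
have l0 : 0 < l by [].
have [q [q0 Rq hq]] := hc l l0.
apply: (sparse_ramsey_property _ d0 unif deg (ltnSn _) Rq q0) => //.
rewrite -/l -/D mulnA [2 * _ * #|V|]mulnC.
set Q := ntower k (c * K * d).
have Q0 : 0 < Q by rewrite ntower_gt0 // !muln_gt0 c0 d0.
have lK : l <= K * d by rewrite /l /K; nia.
have D0 : 0 < D by rewrite muln_gt0 d0.
have hqQ : q <= 2 ^ Q.
  apply: leq_trans hq _; rewrite /= leq_exp2l //; apply: leq_ntower.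
  by rewrite -mulnA leq_mul2l lK orbT.
have hE : 2 * q ^ l <= 2 ^ (1 + Q * l).
  rewrite expnD expn1 leq_mul2l /= expnM.
  by rewrite leq_exp2r.
set Y := (4 * D + 3) ^ l.
(* The terms of the exponent cover, in turn, numerical factors, the number [2 ^ (D ^ l)] of
   patterns, the factors [D] and [D.+1], and the chain density for [t = 2 * D]. *)
have hS : 2 * sparsity l D (2 * q ^ l) * D.+1 < 2 ^ (5 + D ^ l + 2 * D + (1 + Q * l) * Y).
  have h1 := @chain_density_leq (2 * D) _ l _ (isT : 0 < 1 + Q * l) hE.
  rewrite (_ : 2 * (2 * D) + 3 = 4 * D + 3) in h1; last lia.
  rewrite /sparsity card_set_type card_ffun !card_ord.
  move: h1; rewrite -/Y; set ch := chain_density _ _ _ => h1.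
  have h2 := ltn_expl D (isT : 1 < 2).
  move: h1; set y := (1 + Q * l) * Y => h1.
  have -> : 2 * D = D + D by lia.
  rewrite 4!expnD.
  move: h1 h2; set a := 2 ^ D; set p := 2 ^ (D ^ l); set z := 2 ^ y => h1 h2.
  have p0 : 0 < p by rewrite expn_gt0.
  have z0 : 0 < z by rewrite expn_gt0.
  apply: (@leq_ltn_trans (2 * (4 * p * a * z) * a)).
    by apply: leq_mul => //; rewrite leq_mul2l /=; apply: leq_mul => //; rewrite leq_mul2l ltnW ?orbT.
  have : 0 < p * a * z * a by rewrite !muln_gt0 p0 z0 /a !expn_gt0.
  by lia.
(* The base [4 * D + 3] is quadratic in [d], hence exponential in [L], and the exponent [l] is
   linear in [d]; this produces [d * L], the source of the logarithm for uniformity 3. *)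
have hY : Y <= 2 ^ ((4 * K + 5) * (K * (d * L))).
  have h1 : 4 * D + 3 <= (4 * K + 3) * d ^ 2.
    rewrite /D; have : d * l <= d * (K * d) by rewrite leq_mul2l lK orbT.
    rewrite expnS expn1; nia.
  have h2 : 4 * D + 3 <= 2 ^ ((4 * K + 5) * L).
    apply: leq_trans h1 _.
    apply: leq_trans (_ : 2 ^ (4 * K + 3) * (2 ^ L) ^ 2 <= _).
      by apply: leq_mul; [exact/ltnW/ltn_expl | rewrite leq_exp2r].
    by rewrite -expnM -expnD leq_exp2l //; nia.
  apply: leq_trans (_ : (2 ^ ((4 * K + 5) * L)) ^ l <= _); first by rewrite leq_exp2r.
  rewrite -expnM leq_exp2l // -mulnA leq_mul2l; apply/orP; right.
  by rewrite [L * l]mulnC mulnA leq_mul2r lK orbT.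
have h5l : 5 * l <= 2 ^ (5 * K + L).
  rewrite expnD; apply: leq_trans (_ : (5 * K) * d <= _); first by lia.
  by apply: leq_mul => //; exact/ltnW/ltn_expl.
have hM : 5 + D ^ l + 2 * D + (1 + Q * l) * Y <= 5 * l * (Q * Y).
  have y1 : 4 * D + 3 <= Y by rewrite /Y -{1}(expn1 (4 * D + 3)) leq_exp2l //; lia.
  have y2 : D ^ l <= Y by rewrite /Y leq_exp2r //; lia.
  have y3 : 0 < Q * l by rewrite muln_gt0 Q0.
  have : 5 + D ^ l + 2 * D <= 4 * Y by lia.
  nia.
rewrite -[ltnLHS]mulnA [ltnLHS]mulnC ltn_pmul2r //; apply: leq_trans hS _; rewrite leq_exp2l //.
apply: leq_trans hM _.
rewrite mulnCA leq_mul2l; apply/orP; right.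
apply: leq_trans (leq_mul h5l hY) _; rewrite -expnD leq_exp2l //.
have x1 : L <= d * L by rewrite leq_pmull.
have x2 : 5 * K <= 5 * K * (d * L) by rewrite leq_pmulr // muln_gt0 d0.
by move: x1 x2; generalize (d * L), K => u K'; lia.
Qed.

(** A least element exists by classical decidability, so bounding the Ramsey number takes only the
    property at one [N], without monotonicity. *)
Lemma exists_ramsey_number (k : nat) (V : finType) (E : {set {set V}}) (N : nat) :
  ramsey_property k E N -> exists2 r, is_ramsey_number k E r & r <= N.
Proof.
move=> hN; have ex : exists n, boolp.asbool (ramsey_property k E n) by exists N; exact/boolp.asboolP.
case: (ex_minnP ex) => r /boolp.asboolP hr rmin; exists r; last exact/rmin/boolp.asboolP.
by split=> // n hn; apply/rmin/boolp.asboolP.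
Qed.

(** * Real towers and the final bounds *)

Local Open Scope ring_scope.

Lemma natr_ntower (R : realType) (i x : nat) : tower i.+1 x%:R = (ntower i x)%:R :> R.
Proof.
by rewrite /tower /=; elim: i => //= i ->; rewrite powR_mulrn ?ler0n // natrX.
Qed.

Lemma ler_tower (R : realType) (i : nat) (x y : R) : x <= y -> tower i x <= tower i y.
Proof.
by move=> xy; rewrite /tower; elim: i.-1 => //= j IH; apply: ler_powR => //; rewrite ler1n.
Qed.

Lemma ler_natM_tower (R : realType) (r m n : nat) (x y : R) :
  (r <= m * n)%N -> m%:R <= x -> x <= y -> r%:R <= y * n%:R.
Proof.
move=> rmn mx xy; apply: le_trans (_ : (m * n)%:R <= _); first by rewrite ler_nat.
by rewrite natrM ler_wpM2r // (le_trans mx).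
Qed.

Theorem mainTheorem2 (R : realType) (k : nat) (hk : (3 <= k)%N) :
  exists c : R,
    forall (Delta : nat) (V : finType) (E : {set {set V}}),
      (0 < Delta)%N -> uniform k E -> max_degree E = Delta ->
      exists r : nat,
        is_ramsey_number k E r /\
        ((4 <= k)%N ->
           r%:R <= tower k (c * Delta%:R) * #|V|%:R) /\
        (k = 3%N ->
           r%:R <= tower 3 (c * Delta%:R * ln Delta%:R) * #|V|%:R).
Proof.
case: k hk => [|[|k]] // hk.
have [b [c [b0 c0 main]]] := sparse_ramsey_exponent k.
have deg_le (V : finType) (E : {set {set V}}) d v : max_degree E = d -> (degree E v <= d)%N.
  by move=> <-; rewrite /max_degree (bigD1 v) //= leq_maxl.
have card_gt0 (V : finType) (E : {set {set V}}) d : (0 < d)%N -> max_degree E = d -> (0 < #|V|)%N.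
  move=> d0 dE; rewrite lt0n; apply/negP => /eqP V0; move: d0; rewrite -dE /max_degree.
  by rewrite big1 // => v; have := card0_eq V0 v; rewrite inE.
have [k2|k3] := ltnP 1 k.
  (* The uniformity [k.+2] is at least 4 here, and the crude choice [L = d] suffices. Both factors
     of the exponent are at most [ntower k x] with [x = (c + (b + 2)) * d]; the factor [2] absorbs
     their product. *)
  exists (2 * (c + (b + 2)))%:R => d V E d0 unif dE.
  have deg v := deg_le V E d v dE; have V0 := card_gt0 V E d d0 dE.
  have [r hr rN] := exists_ramsey_number
    (main d d V E d0 d0 (ltnW (ltn_expl d (isT : 1 < 2)%N)) V0 unif deg).
  exists r; split=> //; split=> [_|e]; last by rewrite -e in k2 *; lia.
  apply: (@ler_natM_tower R _ _ _ _ _ rN (lexx _)).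
  rewrite -natrM natr_ntower ler_nat [ntower _ _]/= leq_exp2l //.
  case: k k2 {hk main unif hr rN} => [|k] // k2.
  set x := ((c + (b + 2)) * d)%N.
  have x0 : (0 < x)%N by rewrite muln_gt0 d0 addn_gt0 c0.
  rewrite -mulnA -/x; apply: leq_trans (leq_exp_ntower k (isT : 0 < 2)%N x0).
  rewrite expnS expn1; apply: leq_mul.
    by apply: leq_ntower; rewrite leq_mul2r leq_addr orbT.
  have k0 : (0 < k)%N by [].
  case: k k0 {k2} => // k _; rewrite /= leq_exp2l //.
  (* Since [b * (d * d) <= 2 ^ (b + 2 * d)], two exponentials of [x] dominate the second factor, and
     the tower has at least two. *)
  have := leq_ntower_add k 0 x; rewrite addn0 /= => hx.
  apply: leq_trans (_ : 2 ^ x <= _)%N; last by rewrite leq_exp2l.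
  apply: leq_trans (_ : 2 ^ b * (2 ^ d * 2 ^ d) <= _)%N.
    by apply: leq_mul; [|apply: leq_mul]; exact/ltnW/ltn_expl.
  by rewrite -!expnD leq_exp2l // /x; nia.
have k1 : k = 1%N by lia.
subst k.
(* The [2] pays for rounding the binary logarithm up, and [ln 2] for the change of base. *)
exists (2 * (c + b)%:R / ln 2) => d V E d0 unif dE.
have ln2 : 0 < ln (2 : R) by rewrite ln_gt0 // ltr1n.
have deg v := deg_le V E d v dE; have V0 := card_gt0 V E d d0 dE.
have [d1|d2] := leqP d 1.
  have {}d1 : d = 1%N by lia.
  subst d; rewrite d1 in deg *.
  have [r hr rN] := exists_ramsey_number (matching_ramsey_property V0 unif deg).
  exists r; split=> //; split=> // _.
  (* For [Delta = 1] the tower is [2 ^ (2 ^ 0) = 2], exactly the matching bound. *)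
  apply: (@ler_natM_tower R _ _ _ _ _ rN (lexx _)).
  by rewrite ln1 mulr0 /tower /= powRr0 powRr1.
pose L := (trunc_log 2 d).+1.
have dL : (d <= 2 ^ L)%N by apply/ltnW/trunc_log_ltn.
have [r hr rN] := exists_ramsey_number (main d L V E d0 isT dL V0 unif deg).
exists r; split=> //; split=> // _.
apply: (@ler_natM_tower R _ (ntower 2 ((c + b) * (d * L))) _ _ _ _ _ (lexx _)).
  apply: leq_trans rN _; rewrite leq_mul2r; apply/orP; right.
  rewrite /= leq_exp2l // -expnD leq_exp2l // mulnDl leq_add2r leq_mul2l leq_pmulr ?orbT //.
rewrite -natr_ntower; apply: ler_tower.
have hlog : (trunc_log 2 d)%:R * ln 2 <= ln (d%:R : R).
  rewrite mulr_natl -lnXn // ler_ln ?posrE ?exprn_gt0 ?ltr0n // -natrX ler_nat.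
  exact: trunc_logP.
(* As [2 <= d], the rounded-down logarithm is positive, so adding one at most doubles it. *)
have hL : (L%:R : R) <= 2 * (trunc_log 2 d)%:R.
  rewrite -natrM ler_nat /L; have : (0 < trunc_log 2 d)%N by rewrite trunc_log_gt0.
  by lia.
rewrite !natrM.
have -> : 2 * (c + b)%:R / ln 2 * d%:R * ln d%:R =
    (c + b)%:R * (d%:R * (2 * (ln (d%:R : R) / ln 2))) :> R.
  by rewrite -!mulrA; rewrite [(ln 2)^-1 * _]mulrC -!mulrA mulrCA; congr (_ * _); rewrite mulrCA.
apply: ler_wpM2l => //; apply: ler_wpM2l => //; apply: le_trans hL _.
by apply: ler_wpM2l => //; rewrite ler_pdivlMr.
Qed.
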